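(* Let $\mathbb K$ be a field with $2,3\in\mathbb K^\times$ and suppose that $\mathfrak g$ is a $3$-graded Lie algebra over $\mathbb K$ with grading element $E$ satisfying $\mathfrak g_0=\mathbb KE+[\mathfrak g_+,\mathfrak g_-]$. If $\mathfrak g$ is perfect, put $\tilde{\mathfrak g}:=\langle\mathfrak g,\mathfrak g\rangle$; if $\mathfrak g$ is not perfect, put $$\tilde{\mathfrak g}:=\langle\mathfrak g,\mathfrak g\rangle\rtimes\mathbb K\tilde E,$$ where $[\tilde E,\langle x,y\rangle]:=\langle[E,x],y\rangle+\langle x,[E,y]\rangle=\langle E,[x,y]\rangle$. Then there is a unique Lie algebra homomorphism $q_{\mathfrak g}:\tilde{\mathfrak g}\to\mathfrak g$ with $q_{\mathfrak g}(\langle x,y\rangle)=[x,y]$ for all $x,y\in\mathfrak g$ and, if $\mathfrak g$ is not perfect, $q_{\mathfrak g}(\tilde E)=E$. This homomorphism is surjective with central kernel, hence a central extension of $\mathfrak g$. Moreover, it is weakly universal in the sense that for any central extension $q:\hat{\mathfrak g}\to\mathfrak g$ with a $3$-graded Lie algebra $\hat{\mathfrak g}$ with grading element $\hat E\in\hat{\mathfrak g}$, $q(\hat E)=E$, there exists a unique Lie algebra homomorphism $\alpha:\tilde{\mathfrak g}\to\hat{\mathfrak g}$ with $q\circ\alpha=q_{\mathfrak g}$ and, if $\mathfrak g$ is not perfect, with $\alpha(\tilde E)=\hat E$.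
   Context: A $3$-graded Lie algebra with grading element $E\in\mathfrak g$ is a Lie algebra with $\mathrm{ad}(E)^3=\mathrm{ad}(E)$, decomposed as $\mathfrak g=\mathfrak g_+\oplus\mathfrak g_0\oplus\mathfrak g_-$ into the eigenspaces of $\mathrm{ad}(E)$ for $1,0,-1$. $\mathfrak g$ is perfect if $\mathfrak g=[\mathfrak g,\mathfrak g]$. A central extension is a surjective Lie algebra homomorphism whose kernel is central. For a Lie algebra $\mathfrak g$, $\langle\mathfrak g,\mathfrak g\rangle$ denotes the quotient of $\Lambda^2(\mathfrak g)$ by the subspace generated by the elements $[x,y]\wedge z+[y,z]\wedge x+[z,x]\wedge y$, and $\langle x,y\rangle$ is the image of $x\wedge y$. It carries a natural Lie algebra structure with $[\langle x,y\rangle,\langle x',y'\rangle]=\langle[x,y],[x',y']\rangle$. *)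

(* Defs.v *)
From HB Require Import structures.
From mathcomp Require Import all_boot all_algebra.
From mathcomp Require Import boolp classical_sets.
From mathcomp Require Import finmap monalg.

Set Implicit Arguments.
Unset Strict Implicit.
Unset Printing Implicit Defensive.

Import GRing.Theory.
Local Open Scope classical_set_scope.
Local Open Scope ring_scope.

Section Span.
Variables (K : fieldType) (V : lmodType K).
Implicit Types (S W : set V).

Definition subspace W : Prop :=
  W 0 /\ forall (a : K) u v, W u -> W v -> W (a *: u + v).

Definition span S : set V := smallest subspace S.

Lemma span_subspace S : subspace (span S).
Proof.
split=> [W [[W0 _] _] // | a u v Su Sv W /[dup] WS [[_ Wl] _]].
by apply: Wl; [apply: Su | apply: Sv].
Qed.

Lemma sub_span S : S `<=` span S.
Proof. exact: sub_smallest. Qed.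

Lemma span_sub S W : subspace W -> S `<=` W -> span S `<=` W.
Proof. by move=> sW SW v; apply. Qed.

Definition mem_span S : {pred V} := fun v => `[< span S v >].

Lemma mem_spanP S v : reflect (span S v) (v \in mem_span S).
Proof. exact: asboolP. Qed.

Lemma mem_span_closed S : submod_closed (mem_span S).
Proof.
have [S0 Sl] := span_subspace S; split; first by apply/mem_spanP.
by move=> a u v /mem_spanP Su /mem_spanP Sv; apply/mem_spanP; apply: Sl.
Qed.

HB.instance Definition _ S :=
  GRing.isSubmodClosed.Build K V (mem_span S) (mem_span_closed S).

End Span.

(* The quotient of V by the subspace generated by S *)
Definition qspace (K : fieldType) (V : lmodType K) (S : set V) : Type :=
  Quotient.quot (mem_span S : zmodClosed V).

Section QuotientSpace.
Variables (K : fieldType) (V : lmodType K) (S : set V).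
Local Open Scope quotient_scope.
Local Notation Q := (qspace S).

HB.instance Definition _ := GRing.Zmodule.on Q.

Definition qproj (v : V) : Q := \pi_(Quotient.quot (mem_span S : zmodClosed V)) v.

Lemma qproj_surj (w : Q) : exists v, w = qproj v.
Proof. by exists (repr w); rewrite /qproj reprK. Qed.

Lemma qproj_eq u v : qproj u = qproj v <-> span S (u - v).
Proof.
have e := @Quotient.idealrBE V (mem_span S : zmodClosed V) u v.
split=> [/eqP|/mem_spanP]; first by rewrite /qproj -e => /mem_spanP.
by rewrite e => /eqP.
Qed.

Lemma qprojD : {morph qproj : u v / u + v}.
Proof. by move=> u v; rewrite /qproj -[RHS]Quotient.pi_add. Qed.

Definition qscale (a : K) (w : Q) : Q := qproj (a *: repr w).

Lemma qscaleE a v : qscale a (qproj v) = qproj (a *: v).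
Proof.
apply/qproj_eq; rewrite -scalerBr -[_ *: _]addr0.
have [S0 Sl] := span_subspace S; apply: Sl => //.
by apply/qproj_eq; rewrite {1}/qproj reprK.
Qed.

Lemma qscaleA a b w : qscale a (qscale b w) = qscale (a * b) w.
Proof. by have [v ->] := qproj_surj w; rewrite !qscaleE scalerA. Qed.

Lemma qscale1 : left_id 1 qscale.
Proof. by move=> w; have [v ->] := qproj_surj w; rewrite qscaleE scale1r. Qed.

Lemma qscaleDr : right_distributive qscale +%R.
Proof.
move=> a w w'; have [v ->] := qproj_surj w; have [v' ->] := qproj_surj w'.
by rewrite -qprojD !qscaleE scalerDr qprojD.
Qed.

Lemma qscaleDl w : {morph qscale^~ w : a b / a + b}.
Proof.
by move=> a b; have [v ->] := qproj_surj w; rewrite !qscaleE scalerDl qprojD.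
Qed.

HB.instance Definition _ := GRing.Zmodule_isLmodule.Build K Q
  qscaleA qscale1 qscaleDr qscaleDl.

Lemma qproj_is_linear : linear qproj.
Proof. by move=> a u v; rewrite qprojD -qscaleE. Qed.

HB.instance Definition _ := GRing.isLinear.Build K V Q _ qproj qproj_is_linear.

Variables (W : lmodType K) (f : V -> W).

Definition qlift (w : Q) : W := f (repr w).

Hypothesis f_linear : linear f.
Hypothesis fS : forall s, S s -> f s = 0.

Let fl := f.
HB.instance Definition _ := GRing.isLinear.Build K V W _ fl f_linear.

Lemma qliftE v : qlift (qproj v) = f v.
Proof.
apply/eqP; rewrite -subr_eq0 /qlift -/fl -linearB; apply/eqP.
have: span S (repr (qproj v) - v) by apply/qproj_eq; rewrite {1}/qproj reprK.
apply: (@span_sub _ _ S (fun v => fl v = 0)) => //; split=> [|a u u' fu fu'].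
  exact: linear0.
by rewrite linearP /= fu fu' scaler0 addr0.
Qed.

Lemma qlift_is_linear : linear qlift.
Proof.
move=> a w w'; have [v ->] := qproj_surj w; have [v' ->] := qproj_surj w'.
by rewrite -linearP !qliftE f_linear.
Qed.

End QuotientSpace.

Section FreeLift.
Variables (K : fieldType) (T : choiceType) (W : lmodType K) (h : T -> W).

Definition free_lift (f : {malg K[T]}) : W := \sum_(k <- msupp f) f@_k *: h k.

Lemma free_liftEw (d : {fset T}) (f : {malg K[T]}) :
  (msupp f `<=` d)%fset -> free_lift f = \sum_(k <- d) f@_k *: h k.
Proof.
move=> sub; rewrite /free_lift (big_fset_incl _ sub) //= => k _ /mcoeff_outdom ->.
by rewrite scale0r.
Qed.

Lemma free_lift_is_linear : linear free_lift.
Proof.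
move=> a f f'; pose d := (msupp f `|` msupp f')%fset.
rewrite (@free_liftEw d) ?(@free_liftEw d f) ?(@free_liftEw d f') ?fsubsetUl
  ?fsubsetUr //; last first.
  apply: fsubset_trans (msuppD_le _ _) _; rewrite fsetSU //.
  exact: msuppZ_le.
rewrite scaler_sumr -big_split /=; apply: eq_bigr => k _.
by rewrite mcoeffD mcoeffZ scalerDl scalerA.
Qed.

HB.instance Definition _ :=
  GRing.isLinear.Build K {malg K[T]} W _ free_lift free_lift_is_linear.

Lemma free_liftU k : free_lift << k >> = h k.
Proof.
by rewrite (@free_liftEw [fset k]%fset) ?msuppU_le // big_seq_fset1 mcoeffUU scale1r.
Qed.

Lemma free_ind (P : set {malg K[T]}) :
  subspace P -> (forall k, P << k >>) -> forall f, P f.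
Proof.
move=> [P0 Pl] PU f; rewrite (monalgE f); elim/big_ind: _ => // [x y Px Py|k _].
  by rewrite -[x]scale1r; apply: Pl.
have -> : << f@_k *g k >> = f@_k *: << k >> :> {malg K[T]}.
  by apply/malgP => k'; rewrite mcoeffZ !mcoeffU mulr_natr.
by rewrite -[_ *: _]addr0; apply: Pl.
Qed.

End FreeLift.

(* Λ²V is the free vector space on V × V modulo bilinearity and v ∧ v = 0. *)
Section ExteriorSquare.
Variables (K : fieldType) (V : lmodType K).

Definition ext2_rel : set {malg K[(V * V)%type]} :=
  [set r | exists a x y z,
      r = << (a *: x + y, z) >> - a *: << (x, z) >> - << (y, z) >>]
  `|` [set r | exists a x y z,
      r = << (z, a *: x + y) >> - a *: << (z, x) >> - << (z, y) >>]
  `|` [set r | exists x, r = << (x, x) >>].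

Definition ext2 : Type := qspace ext2_rel.
HB.instance Definition _ := GRing.Lmodule.on ext2.

Definition wedge (x y : V) : ext2 := qproj ext2_rel << (x, y) >>.

Lemma wedgePl a x y z : wedge (a *: x + y) z = a *: wedge x z + wedge y z.
Proof.
apply/eqP; rewrite -subr_eq0 opprD addrA /wedge -!linearZ -!linearB /=; apply/eqP.
rewrite -(linear0 (qproj ext2_rel)); apply/qproj_eq; rewrite subr0.
by apply: sub_span; left; left; exists a, x, y, z.
Qed.

Lemma wedgePr a x y z : wedge z (a *: x + y) = a *: wedge z x + wedge z y.
Proof.
apply/eqP; rewrite -subr_eq0 opprD addrA /wedge -!linearZ -!linearB /=; apply/eqP.
rewrite -(linear0 (qproj ext2_rel)); apply/qproj_eq; rewrite subr0.
by apply: sub_span; left; right; exists a, x, y, z.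
Qed.

Lemma wedgexx x : wedge x x = 0.
Proof.
rewrite -(linear0 (qproj ext2_rel)); apply/qproj_eq; rewrite subr0.
by apply: sub_span; right; exists x.
Qed.

Lemma ext2_ind (P : set ext2) :
  subspace P -> (forall x y, P (wedge x y)) -> forall w, P w.
Proof.
move=> [P0 Pl] Pw w; have [f ->] := qproj_surj w.
apply: (@free_ind _ _ (fun f => P (qproj ext2_rel f))) => [|[x y]]; last exact: Pw.
by split=> [|a u v Pu Pv]; rewrite ?linear0 // linearP; apply: Pl.
Qed.

Section Lift.
Variables (W : lmodType K) (b : V -> V -> W).
Hypothesis bPl : forall z, linear (b^~ z).
Hypothesis bPr : forall z, linear (b z).
Hypothesis bxx : forall x, b x x = 0.

Definition ext2_lift : ext2 -> W := qlift (free_lift (fun p => b p.1 p.2)).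

Lemma ext2_lift_rel s : ext2_rel s -> free_lift (fun p => b p.1 p.2) s = 0.
Proof.
case=> [[]|] => [[a [x [y [z ->]]]]|[a [x [y [z ->]]]]|[x ->]].
- by rewrite !linearB linearZ /= !free_liftU /= bPl addrAC addrK subrr.
- by rewrite !linearB linearZ /= !free_liftU /= bPr addrAC addrK subrr.
- by rewrite free_liftU.
Qed.

Lemma ext2_liftE x y : ext2_lift (wedge x y) = b x y.
Proof.
rewrite /ext2_lift /wedge qliftE; first exact: free_liftU.
- exact: linearP.
- by move=> s /ext2_lift_rel.
Qed.

Lemma ext2_lift_is_linear : linear ext2_lift.
Proof. by apply: qlift_is_linear => [|s /ext2_lift_rel //]; apply: linearP. Qed.

End Lift.

End ExteriorSquare.

HB.mixin Record isLieAlgebra (K : fieldType) L of GRing.Lmodule K L := {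
  lie : L -> L -> L;
  lie_linearl : forall z, linear (lie^~ z);
  lie_linearr : forall z, linear (lie z);
  liexx : forall x, lie x x = 0;
  lie_jacobi : forall x y z,
    lie x (lie y z) + lie y (lie z x) + lie z (lie x y) = 0
}.

#[short(type="lieAlgType")]
HB.structure Definition LieAlgebra (K : fieldType) :=
  {L of GRing.Lmodule K L & isLieAlgebra K L}.

Notation "⁅ x , y ⁆" := (lie x y) (at level 0, format "⁅ x ,  y ⁆") : ring_scope.

Section LieTheory.
Variables (K : fieldType) (g : lieAlgType K).
Implicit Types (x y z E : g) (A B : set g).

HB.instance Definition _ x :=
  GRing.isLinear.Build K g g _ (lie x) (lie_linearr x).

Definition ad x y : g := ⁅x, y⁆.
HB.instance Definition _ x :=
  GRing.isLinear.Build K g g _ (ad x) (lie_linearr x).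

Lemma lieDl x y z : ⁅x + y, z⁆ = ⁅x, z⁆ + ⁅y, z⁆.
Proof. by rewrite -[x]scale1r lie_linearl !scale1r. Qed.

Lemma lieC x y : ⁅x, y⁆ = - ⁅y, x⁆.
Proof.
apply/eqP; rewrite -addr_eq0; apply/eqP; have := liexx (x + y).
by rewrite lieDl !linearD /= !liexx add0r addr0.
Qed.

Lemma lieZl a x y : ⁅a *: x, y⁆ = a *: ⁅x, y⁆.
Proof. by rewrite lieC linearZ /= -scalerN -lieC. Qed.

Lemma lieNl x y : ⁅- x, y⁆ = - ⁅x, y⁆.
Proof. by rewrite -scaleN1r lieZl scaleN1r. Qed.

Lemma lie0l x : ⁅0, x⁆ = 0.
Proof. by rewrite lieC linear0 oppr0. Qed.

Lemma lie_leibniz x y z : ⁅x, ⁅y, z⁆⁆ = ⁅⁅x, y⁆, z⁆ + ⁅y, ⁅x, z⁆⁆.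
Proof.
apply/eqP; rewrite -subr_eq0 opprD addrA; apply/eqP; rewrite -(lie_jacobi x y z).
by rewrite addrAC (lieC z x) linearN /= (lieC z).
Qed.

Definition lie_span A B : set g := span [set ⁅x, y⁆ | x in A & y in B].

Definition perfect : Prop := lie_span setT setT = setT.

Definition center : set g := [set z | forall x, ⁅z, x⁆ = 0].

Definition three_graded E : Prop := iter 3 (ad E) =1 ad E.

(* the eigenspace of ad E; g₊, g₀, g₋ are those for 1, 0, -1 *)
Definition ad_eigen E (c : K) : set g := [set x | ad E x = c *: x].

Lemma three_graded_decomposition E x : (2 : K) != 0 -> three_graded E ->
  exists xp x0 xm, [/\ ad_eigen E 1 xp, ad_eigen E 0 x0, ad_eigen E (-1) xm
                     & x = xp + x0 + xm].
Proof.
move=> h2 hE; set y := ad E x; set z := ad E y.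
have Ez : ad E z = y by apply: hE.
exists (2^-1 *: (z + y)), (x - z), (2^-1 *: (z - y));
  split; rewrite /ad_eigen /=.
- by rewrite linearZ linearD /= Ez -/z scale1r addrC.
- by rewrite linearB /= Ez subrr scale0r.
- by rewrite linearZ linearB /= Ez -/z scaleN1r -scalerN opprB.
rewrite addrAC -scalerDr addrACA subrr addr0 -mulr2n -scaler_nat scalerA mulVf //.
by rewrite scale1r addrC subrK.
Qed.

End LieTheory.

Definition lie_hom (K : fieldType) (g h : lieAlgType K) (f : g -> h) : Prop :=
  linear f /\ forall x y, f ⁅x, y⁆ = ⁅f x, f y⁆.

Definition central_extension (K : fieldType) (h g : lieAlgType K) (q : h -> g) :
    Prop :=
  [/\ lie_hom q, range q = setT & q @^-1` [set 0] `<=` @center K h].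

Definition ang_rel (K : fieldType) (g : lieAlgType K) : set (ext2 g) :=
  [set r | exists x y z,
     r = wedge ⁅x, y⁆ z + wedge ⁅y, z⁆ x + wedge ⁅z, x⁆ y].

(* ⟨g, g⟩ = Λ²g / span of ang_rel *)
Definition angle_alg (K : fieldType) (g : lieAlgType K) : Type :=
  qspace (@ang_rel K g).

Section Angle.
Variables (K : fieldType) (g : lieAlgType K).
Local Notation G := (angle_alg g).

HB.instance Definition _ := GRing.Lmodule.on G.

Definition ang (x y : g) : G := qproj (@ang_rel K g) (wedge x y).

Local Notation "⟨ x , y ⟩" := (ang x y) (at level 0).

Lemma ang_linearl z : linear (ang^~ z).
Proof. by move=> a x y; rewrite /ang wedgePl linearP. Qed.

Lemma ang_linearr z : linear (ang z).
Proof. by move=> a x y; rewrite /ang wedgePr linearP. Qed.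

HB.instance Definition _ x := GRing.isLinear.Build K g G _ (ang x) (ang_linearr x).

Lemma angxx x : ⟨x, x⟩ = 0.
Proof. by rewrite /ang wedgexx linear0. Qed.

Lemma ang_jacobi x y z : ⟨⁅x, y⁆, z⟩ + ⟨⁅y, z⁆, x⟩ + ⟨⁅z, x⁆, y⟩ = 0.
Proof.
rewrite /ang -!(linearD (qproj (@ang_rel K g))) -(linear0 (qproj (@ang_rel K g))); apply/qproj_eq.
by rewrite subr0; apply: sub_span; exists x, y, z.
Qed.

Lemma angDl x y z : ⟨x + y, z⟩ = ⟨x, z⟩ + ⟨y, z⟩.
Proof. by rewrite -[x]scale1r ang_linearl !scale1r. Qed.

Lemma angC x y : ⟨x, y⟩ = - ⟨y, x⟩.
Proof.
apply/eqP; rewrite -addr_eq0; apply/eqP; have := angxx (x + y).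
by rewrite angDl !linearD /= !angxx add0r addr0.
Qed.

Lemma ang_leibniz x y z : ⟨x, ⁅y, z⁆⟩ = ⟨⁅x, y⁆, z⟩ + ⟨y, ⁅x, z⁆⟩.
Proof.
have := ang_jacobi x y z; rewrite (angC _ x) (angC _ y) (lieC z x) linearN opprK /=.
by move=> /eqP; rewrite addrAC subr_eq0 => /eqP ->.
Qed.

Lemma angle_ind (P : set G) :
  subspace P -> (forall x y, P ⟨x, y⟩) -> forall w, P w.
Proof.
move=> [P0 Pl] Pw w; have [t ->] := qproj_surj w.
apply: (@ext2_ind _ _ (fun t => P (qproj (@ang_rel K g) t))); last exact: Pw.
by split=> [|a u v Pu Pv]; rewrite ?linear0 // linearP; apply: Pl.
Qed.

Section Lift.
Variables (W : lmodType K) (b : g -> g -> W).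
Hypothesis bPl : forall z, linear (b^~ z).
Hypothesis bPr : forall z, linear (b z).
Hypothesis bxx : forall x, b x x = 0.
Hypothesis bjac : forall x y z, b ⁅x, y⁆ z + b ⁅y, z⁆ x + b ⁅z, x⁆ y = 0.

Definition angle_lift : G -> W := qlift (ext2_lift b).

Let bl := ext2_lift b.
Let bl_linear : linear bl := ext2_lift_is_linear bPl bPr bxx.
HB.instance Definition _ := GRing.isLinear.Build K (ext2 g) W _ bl bl_linear.

Lemma angle_lift_rel s : ang_rel s -> bl s = 0.
Proof. by case=> x [y [z ->]]; rewrite !linearD /= /bl !ext2_liftE. Qed.

Lemma angle_liftE x y : angle_lift ⟨x, y⟩ = b x y.
Proof.
rewrite /angle_lift /ang qliftE; first by rewrite ext2_liftE.
- exact: bl_linear.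
- by move=> s /angle_lift_rel.
Qed.

Lemma angle_lift_is_linear : linear angle_lift.
Proof. by apply: qlift_is_linear => [|s /angle_lift_rel]; first exact: bl_linear. Qed.

End Lift.

Lemma lie_jacobi_swap (x y z : g) : ⁅⁅x, y⁆, z⁆ + ⁅⁅y, z⁆, x⁆ + ⁅⁅z, x⁆, y⁆ = 0.
Proof.
by rewrite (lieC ⁅x, y⁆) (lieC ⁅y, z⁆) (lieC ⁅z, x⁆) -!opprD (lie_jacobi z x y) oppr0.
Qed.

Definition angle_map : G -> g := angle_lift (@lie K g).

Lemma angle_mapE x y : angle_map ⟨x, y⟩ = ⁅x, y⁆.
Proof.
exact: angle_liftE (@lie_linearl K g) (@lie_linearr K g) (@liexx K g)
  lie_jacobi_swap x y.
Qed.

Lemma angle_map_is_linear : linear angle_map.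
Proof.
exact: angle_lift_is_linear (@lie_linearl K g) (@lie_linearr K g) (@liexx K g)
  lie_jacobi_swap.
Qed.

HB.instance Definition _ :=
  GRing.isLinear.Build K G g _ angle_map angle_map_is_linear.

(* The bilinear extension of [⟨x, y⟩, ⟨x', y'⟩] = ⟨[x, y], [x', y']⟩; the values
   on generators are angle_bracketE *)
Definition angle_bracket (u v : G) : G := ⟨angle_map u, angle_map v⟩.

Lemma angle_bracket_linearl w : linear (angle_bracket^~ w).
Proof. by move=> a u v; rewrite /angle_bracket linearP ang_linearl. Qed.

Lemma angle_bracket_linearr w : linear (angle_bracket w).
Proof. by move=> a u v; rewrite /angle_bracket !linearP. Qed.

Lemma angle_bracketxx u : angle_bracket u u = 0.
Proof. exact: angxx. Qed.

Lemma angle_bracket_jacobi u v w :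
  angle_bracket u (angle_bracket v w) + angle_bracket v (angle_bracket w u)
  + angle_bracket w (angle_bracket u v) = 0.
Proof.
rewrite /angle_bracket !angle_mapE.
set x := angle_map u; set y := angle_map v; set z := angle_map w.
by rewrite (angC x) (angC y) (angC z) -!opprD (ang_jacobi y z x) oppr0.
Qed.

HB.instance Definition _ := isLieAlgebra.Build K G angle_bracket_linearl
  angle_bracket_linearr angle_bracketxx angle_bracket_jacobi.

Lemma angle_bracketE x y x' y' : ⁅⟨x, y⟩, ⟨x', y'⟩⁆ = ⟨⁅x, y⁆, ⁅x', y'⁆⟩.
Proof. by rewrite {1}/lie /= /angle_bracket !angle_mapE. Qed.

End Angle.

Notation "⟨ x , y ⟩" := (ang x y) (at level 0, format "⟨ x ,  y ⟩") : ring_scope.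

Record derivation (K : fieldType) (n : lieAlgType K) := Derivation {
  der_fun :> n -> n;
  der_linear : linear der_fun;
  der_leibniz : forall u v, der_fun ⁅u, v⁆ = ⁅der_fun u, v⁆ + ⁅u, der_fun v⁆
}.

(* n ⋊ K e, where [e, u] = D u; the pair (u, a) stands for u + a e *)
Definition semidirect (K : fieldType) (n : lieAlgType K) (D : derivation n) :
  Type := (n * K^o)%type.

Section Semidirect.
Variables (K : fieldType) (n : lieAlgType K) (D : derivation n).
Local Notation S := (semidirect D).

HB.instance Definition _ := GRing.Lmodule.on S.
HB.instance Definition _ := GRing.isLinear.Build K n n _ D (der_linear D).

Definition sd_bracket (p q : S) : S :=
  (⁅p.1, q.1⁆ + (p.2 : K) *: D q.1 - (q.2 : K) *: D p.1, 0).

Lemma sd_bracketxx p : sd_bracket p p = 0.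
Proof. by rewrite /sd_bracket liexx add0r subrr. Qed.

Lemma sd_bracketC p q : sd_bracket p q = - sd_bracket q p.
Proof.
rewrite /sd_bracket; congr pair => /=; last by rewrite oppr0.
by rewrite !opprD opprK -lieC addrAC.
Qed.

Lemma sd_bracket_linearl r : linear (sd_bracket^~ r).
Proof.
move=> a [u b] [v c]; case: r => w d; rewrite /sd_bracket /=; congr pair => /=.
  rewrite lie_linearl linearP /= !scalerDl !scalerDr !scalerA !scalerN !scalerA.
  by rewrite [d * a]mulrC !opprD !addrA [LHS](ACl (1*3*5*2*4*6)).
by rewrite addr0 scaler0.
Qed.

Lemma sd_bracket_linearr r : linear (sd_bracket r).
Proof.
move=> a p q; rewrite sd_bracketC sd_bracket_linearl opprD -scalerN.
by rewrite -!sd_bracketC.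
Qed.

Lemma sd_bracket_jacobi p q r :
  sd_bracket p (sd_bracket q r) + sd_bracket q (sd_bracket r p)
  + sd_bracket r (sd_bracket p q) = 0.
Proof.
case: p q r => [u a] [v b] [w c]; rewrite /sd_bracket /=.
congr pair => /=; last by rewrite !addr0.
rewrite !scale0r !subr0.
rewrite !linearB !linearD /=; rewrite !linearZ /= !der_leibniz !scalerDr !scalerA /=.
rewrite (lieC (D v) w) (lieC (D w) u) (lieC (D u) v) !scalerN.
rewrite !addrA.
rewrite [LHS](ACl (1*8*15*(2*11)*(19*3)*(16*4)*(5*10)*(6*14)*(20*7)*(9*18)
  *(12*17)*(13*21))) /=.
by rewrite lie_jacobi !subrr !addr0.
Qed.

HB.instance Definition _ := isLieAlgebra.Build K S sd_bracket_linearl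
  sd_bracket_linearr sd_bracketxx sd_bracket_jacobi.

Definition sd_in (u : n) : S := (u, 0).

Definition sd_gen : S := (0, 1).

Lemma sd_inM u v : ⁅sd_in u, sd_in v⁆ = sd_in ⁅u, v⁆.
Proof. by rewrite {1}/lie /= /sd_bracket /= !scale0r subr0 addr0. Qed.

Lemma sd_genM u : ⁅sd_gen, sd_in u⁆ = sd_in (D u).
Proof.
by rewrite /lie /= /sd_bracket /= lie0l scale1r scale0r subr0 add0r.
Qed.

End Semidirect.

Section AngleDerivation.
Variables (K : fieldType) (g : lieAlgType K) (E : g).

(* ⟨x, y⟩ ↦ ⟨[E, x], y⟩ + ⟨x, [E, y]⟩ = ⟨E, [x, y]⟩, see angle_derE *)
Definition angle_der_fun (w : angle_alg g) : angle_alg g := ⟨E, angle_map w⟩.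

Lemma angle_der_linear : linear angle_der_fun.
Proof. by move=> a u v; rewrite /angle_der_fun !linearP. Qed.

Lemma angle_map_bracket (u v : angle_alg g) :
  angle_map ⁅u, v⁆ = ⁅angle_map u, angle_map v⁆.
Proof. exact: angle_mapE. Qed.

Lemma angle_der_leibniz u v :
  angle_der_fun ⁅u, v⁆ = ⁅angle_der_fun u, v⁆ + ⁅u, angle_der_fun v⁆.
Proof.
rewrite /angle_der_fun angle_map_bracket ang_leibniz.
by rewrite /lie /= /angle_bracket !angle_mapE.
Qed.

Definition angle_der : derivation (angle_alg g) :=
  Derivation angle_der_linear angle_der_leibniz.

Lemma angle_derE x y :
  angle_der ⟨x, y⟩ = ⟨⁅E, x⁆, y⟩ + ⟨x, ⁅E, y⁆⟩ /\ angle_der ⟨x, y⟩ = ⟨E, ⁅x, y⁆⟩.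
Proof. by rewrite /= /angle_der_fun angle_mapE ang_leibniz. Qed.

End AngleDerivation.

(* Main.v *)
Require Import Defs.
From mathcomp Require Import all_boot all_algebra.
From mathcomp Require Import boolp classical_sets.

Import GRing.Theory.
Local Open Scope classical_set_scope.
Local Open Scope ring_scope.

Set Implicit Arguments.
Unset Strict Implicit.

(** The Lie bracket of [g] factors as [x, y ↦ angle_map ⟨x, y⟩], and the bracket
of each of the two candidates [T] for the extension has the same shape: if [p]
maps to [x] and [p'] to [y] in [g], then [⁅p, p'⁆] is the copy of [⟨x, y⟩] in [T]
(for [⟨g, g⟩] this is the definition, for the semidirect product it is
[sd_bracketE]). This identity gives almost everything at once.
- The kernel of [T -> g] is central, since [⟨0, y⟩ = 0].
- As soon as [T -> g] is surjective, the copy of [⟨g, g⟩] in [T] is spanned by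
  brackets of [T]. Two homomorphisms to a central extension [q : h -> g] that
  agree after [q] agree on brackets ([hom_eq_on_brackets]), hence on [⟨g, g⟩];
  in the semidirect product only the value at the extra generator is left, and it
  is prescribed.
- The bracket of [h] depends only on the images in [g] of its arguments, so it
  descends to a linear map [⟨g, g⟩ -> h] ([central_extension_lift]), which is
  the required lift, extended by [F] on the extra generator.

Surjectivity is where the grading enters. The image of [⟨g, g⟩] is [[g, g]], so
it is all of [g] when [g] is perfect. In general [[g, g]] contains
the eigenspaces of [ad E] for [1] and [-1], because [x = ±⁅E, x⁆] there, and it
contains the zero eigenspace up to multiples of [E] by hypothesis; so
[g = [g, g] + K E] ([three_graded_sum]). *)

(** * Linear maps and the space ⟨g, g⟩ *)

Lemma linear_map_sub0 {K : fieldType} {V W : lmodType K} (f : V -> W) :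
  linear f -> {morph f : x y / x - y} /\ f 0 = 0.
Proof.
move=> fl; split=> [x y|].
  by rewrite addrC -scaleN1r fl scaleN1r addrC.
by have := fl (-1) 0 0; rewrite scaler0 addr0 scaleN1r addNr.
Qed.

Lemma angle_linear_eq {K : fieldType} {g : lieAlgType K} {W : lmodType K}
    (f f' : angle_alg g -> W) :
  linear f -> linear f' -> (forall x y, f ⟨x, y⟩ = f' ⟨x, y⟩) -> f =1 f'.
Proof.
move=> fl fl' ff'.
apply: (@angle_ind _ _ (fun w => f w = f' w)) => //; split=> [|a u v fu fv].
  by have [_ ->] := linear_map_sub0 fl; have [_ ->] := linear_map_sub0 fl'.
by rewrite fl fl' fu fv.
Qed.

Lemma lie_span_angle_map {K : fieldType} {g : lieAlgType K} (A B : set g) x :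
  lie_span A B x -> exists w, x = angle_map w.
Proof.
apply: (@span_sub _ _ _ (fun x => exists w, x = angle_map w)) => [|z].
  split=> [|a _ _ [u ->] [v ->]]; first by exists 0; rewrite linear0.
  by exists (a *: u + v); rewrite linearP.
by case=> y _ [y' _ <-]; exists ⟨y, y'⟩; rewrite angle_mapE.
Qed.

Lemma perfect_angle_map {K : fieldType} {g : lieAlgType K} :
  perfect g -> forall x : g, exists w, x = angle_map w.
Proof.
by move=> gP x; apply: (@lie_span_angle_map _ _ setT setT); rewrite gP.
Qed.

(** The components [xp] and [xm] of an element are [⁅E, xp⁆] and [- ⁅E, xm⁆], and
the zero component is controlled by the hypothesis. *)
Lemma three_graded_sum {K : fieldType} {g : lieAlgType K} (E : g) :
  (2 : K) != 0 -> three_graded E ->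
  ad_eigen E 0 `<=`
    [set a *: E + v | a in [set: K] & v in lie_span (ad_eigen E 1) (ad_eigen E (-1))] ->
  forall x, exists w a, x = angle_map w + a *: E.
Proof.
move=> h2 hE h0 x.
have [xp [x0 [xm [xpE x0E xmE ->]]]] := three_graded_decomposition x h2 hE.
have [a _ [v vS <-]] := h0 _ x0E; have [w ->] := lie_span_angle_map vS.
exists (⟨E, xp⟩ + w - ⟨E, xm⟩), a.
rewrite linearB linearD /= !angle_mapE; move: xpE xmE.
rewrite /ad_eigen /ad /= => -> ->; rewrite scale1r scaleN1r opprK.
by rewrite addrA [RHS]addrAC; congr (_ + _); apply: addrAC.
Qed.

(** * Central extensions *)

Section CentralExtension.
Variables (K : fieldType) (h g : lieAlgType K) (q : h -> g).
Hypothesis qC : central_extension q.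

Lemma central_bracket_eq x x' y y' :
  q x = q x' -> q y = q y' -> ⁅x, y⁆ = ⁅x', y'⁆.
Proof.
have [[ql _] _ kerq] := qC.
have bl z z' t : q z = q z' -> ⁅z, t⁆ = ⁅z', t⁆.
  move=> qz; have /kerq/(_ t) : q (z - z') = 0.
    by have [-> _] := linear_map_sub0 ql; rewrite qz subrr.
  by rewrite lieDl lieNl => /eqP; rewrite subr_eq0 => /eqP.
by move=> qx qy; rewrite (bl _ _ _ qx) lieC (bl _ _ _ qy) -lieC.
Qed.

(** The two homomorphisms differ by a map to the center, which brackets kill. *)
Lemma hom_eq_on_brackets {T : lieAlgType K} (f f' : T -> h) :
  lie_hom f -> lie_hom f' -> q \o f =1 q \o f' ->
  forall p p', f ⁅p, p'⁆ = f' ⁅p, p'⁆.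
Proof.
by move=> [_ fM] [_ fM'] ff' p p'; rewrite fM fM'; apply: central_bracket_eq;
  apply: ff'.
Qed.

(** By centrality the bracket of lifts does not depend on the lifts, which makes
it bilinear in the lifted elements although the chosen section is not linear. *)
Lemma central_extension_lift :
  exists2 phi : angle_alg g -> h,
    lie_hom phi /\ (forall w, q (phi w) = angle_map w) &
    forall x y, phi ⟨q x, q y⟩ = ⁅x, y⁆.
Proof.
have [[ql qM] qsurj kerq] := qC.
have /choice [s sK] : forall x, exists y, q y = x.
  by move=> x; have : range q x by [rewrite qsurj|]; case=> y _ <-; exists y.
pose b x y := ⁅s x, s y⁆.
have bPl z : linear (b^~ z).
  move=> a x y; rewrite /b -lie_linearl.
  by apply: central_bracket_eq => //; rewrite ql !sK.
have bPr z : linear (b z).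
  move=> a x y; rewrite /b -lie_linearr.
  by apply: central_bracket_eq => //; rewrite ql !sK.
have bxx x : b x x = 0 by apply: liexx.
have bM x y z : b ⁅x, y⁆ z = ⁅⁅s x, s y⁆, s z⁆.
  by apply: central_bracket_eq; rewrite ?qM !sK.
have bjac x y z : b ⁅x, y⁆ z + b ⁅y, z⁆ x + b ⁅z, x⁆ y = 0.
  by rewrite !bM lie_jacobi_swap.
have phiE := angle_liftE bPl bPr bxx bjac.
have phil := angle_lift_is_linear bPl bPr bxx bjac.
have qphi w : q (angle_lift b w) = angle_map w.
  move: w; apply: angle_linear_eq => [a u v||x y].
  - by rewrite phil ql.
  - exact: angle_map_is_linear.
  - by rewrite phiE angle_mapE qM !sK.
exists (angle_lift b) => [|x y]; last first.
  by rewrite phiE; apply: central_bracket_eq; rewrite sK.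
split=> //; split=> // u v.
by rewrite {1}/lie /= /angle_bracket phiE; apply: central_bracket_eq; rewrite sK qphi.
Qed.

End CentralExtension.

(** * The semidirect product ⟨g, g⟩ ⋊ K Ẽ *)

Section Semidirect.
Variables (K : fieldType) (g : lieAlgType K) (E : g).
Local Notation D := (angle_der E).

Definition sd_map (p : semidirect D) : g := angle_map p.1 + (p.2 : K) *: E.

Lemma sd_decomp (p : semidirect D) : p = (p.2 : K) *: sd_gen D + sd_in D p.1.
Proof.
by case: p => u a; congr pair; rewrite /= ?scaler0 ?add0r // addr0 [RHS]mulr1.
Qed.

Lemma sd_map_linear : linear sd_map.
Proof.
move=> a p p'; rewrite /sd_map /= linearP scalerDl scalerDr -scalerA !addrA.
by congr (_ + _); rewrite addrAC.
Qed.

Lemma sd_map_in u : sd_map (sd_in D u) = angle_map u.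
Proof. by rewrite /sd_map /= scale0r addr0. Qed.

Lemma sd_map_gen : sd_map (sd_gen D) = E.
Proof. by rewrite /sd_map /= linear0 add0r scale1r. Qed.

(** With [p = u + a Ẽ] and [p' = v + b Ẽ] this is the expansion of
[⟨angle_map u + a E, angle_map v + b E⟩], whose [⟨E, E⟩] term vanishes. *)
Lemma sd_bracketE (p p' : semidirect D) :
  ⁅p, p'⁆ = sd_in D ⟨sd_map p, sd_map p'⟩.
Proof.
case: p p' => [u a] [v b]; rewrite {1}/lie /= /sd_bracket /=; congr pair.
rewrite /sd_map /= /angle_der_fun {1}/lie /= /angle_bracket.
rewrite ![angle_map _ + _]addrC ang_linearl !ang_linearr angxx scaler0 add0r.
by rewrite (angC _ E) !scalerN addrA addrC addrA.
Qed.

Lemma sd_map_hom : lie_hom sd_map.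
Proof.
by split=> [|p p']; [apply: sd_map_linear | rewrite sd_bracketE sd_map_in angle_mapE].
Qed.

Lemma sd_linear_eq {W : lmodType K} (f f' : semidirect D -> W) :
  linear f -> linear f' ->
  (forall x y, f (sd_in D ⟨x, y⟩) = f' (sd_in D ⟨x, y⟩)) ->
  f (sd_gen D) = f' (sd_gen D) -> f =1 f'.
Proof.
move=> fl fl' ff' fgen p; rewrite (sd_decomp p) fl fl' fgen; congr (_ + _).
have inl a u v : sd_in D (a *: u + v) = a *: sd_in D u + sd_in D v.
  by congr pair; rewrite /= scaler0 addr0.
move: p.1; apply: (@angle_linear_eq _ _ _ (f \o sd_in D) (f' \o sd_in D)) => // a u v.
  by rewrite /= inl fl.
by rewrite /= inl fl'.
Qed.

(** The homomorphism property is automatic: [⁅F, phi w⁆] and [phi ⟨E, angle_map w⟩]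
are brackets of lifts of the same elements. *)
Lemma sd_central_extension_lift {h : lieAlgType K} (F : h) (q : h -> g) :
  central_extension q -> q F = E ->
  exists alpha : semidirect D -> h,
    [/\ lie_hom alpha, q \o alpha = sd_map & alpha (sd_gen D) = F].
Proof.
move=> qC qF; have [[ql qM] _ _] := qC.
have [phi [[phil phiM] qphi] phiE] := central_extension_lift qC.
have [_ phi0] := linear_map_sub0 phil.
pose alpha (p : semidirect D) := (p.2 : K) *: F + phi p.1.
have qa p : q (alpha p) = sd_map p by rewrite /alpha ql qF qphi addrC.
exists alpha; split.
- split=> [a p p'|p p'].
    rewrite /alpha /= phil scalerDl scalerDr -scalerA !addrA.
    by congr (_ + _); rewrite addrAC.
  by rewrite sd_bracketE /alpha /= scale0r add0r -!qa phiE.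
- exact: funext.
- by rewrite /alpha /= phi0 addr0 scale1r.
Qed.

End Semidirect.

(** * The weakly universal central extension *)

Unset Implicit Arguments.

Theorem theorem7p8 (K : fieldType) (g : lieAlgType K) (E : g)
  (h2 : (2 : K) \is a GRing.unit) (h3 : (3 : K) \is a GRing.unit)
  (hE : three_graded E)
  (h0 : ad_eigen E 0 =
    [set a *: E + v | a in [set: K] & v in lie_span (ad_eigen E 1) (ad_eigen E (-1))]) :
  (perfect g ->
    let is_qg (qg : angle_alg g -> g) :=
      lie_hom qg /\ (forall x y, qg ⟨x, y⟩ = ⁅x, y⁆) in
    (exists! qg, is_qg qg) /\
    (forall qg, is_qg qg ->
      central_extension qg /\
      forall (h : lieAlgType K) (F : h) (q : h -> g),
        three_graded F -> central_extension q -> q F = E ->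
        exists! alpha : angle_alg g -> h, lie_hom alpha /\ q \o alpha = qg)) /\
  (~ perfect g ->
    let D := angle_der E in
    (forall x y,
      ⁅sd_gen D, sd_in D ⟨x, y⟩⁆ = sd_in D (⟨⁅E, x⁆, y⟩ + ⟨x, ⁅E, y⁆⟩) /\
      sd_in D (⟨⁅E, x⁆, y⟩ + ⟨x, ⁅E, y⁆⟩) = sd_in D ⟨E, ⁅x, y⁆⟩) /\
    let is_qg (qg : semidirect D -> g) :=
      [/\ lie_hom qg, (forall x y, qg (sd_in D ⟨x, y⟩) = ⁅x, y⁆)
        & qg (sd_gen D) = E] in
    (exists! qg, is_qg qg) /\
    (forall qg, is_qg qg ->
      central_extension qg /\
      forall (h : lieAlgType K) (F : h) (q : h -> g),
        three_graded F -> central_extension q -> q F = E ->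
        exists! alpha : semidirect D -> h,
          [/\ lie_hom alpha, q \o alpha = qg & alpha (sd_gen D) = F])).
Proof.
split=> [gP is_qg | _ D].
  have qgP : is_qg (@angle_map K g).
    split; last exact: angle_mapE.
    by split; [apply: angle_map_is_linear | apply: angle_map_bracket].
  have qg_uniq qg : is_qg qg -> @angle_map K g = qg.
    move=> [[qgl _] qgE]; apply/funext/angle_linear_eq => // [|x y].
      exact: angle_map_is_linear.
    by rewrite angle_mapE qgE.
  have surj := perfect_angle_map gP.
  split=> [|_ /qg_uniq <-]; first by exists (@angle_map K g).
  split=> [|h F q _ qC _].
    split; [by case: qgP | | ].
      by apply/seteqP; split=> // x _; have [w ->] := surj x; exists w.
    by move=> u /= u0 v; rewrite /lie /= /angle_bracket u0 angC linear0 oppr0.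
  have [phi [phiM qphi] _] := central_extension_lift qC.
  exists phi; split=> [|f [fM qf]]; first by split=> //; apply: funext.
  have qphif : q \o phi =1 q \o f by rewrite qf.
  apply/funext/angle_linear_eq => [||x y]; [by case: phiM | by case: fM | ].
  have [[u ->] [v ->]] := (surj x, surj y).
  exact: (hom_eq_on_brackets qC phiM fM qphif u v).
split=> [x y | is_qg]; first by rewrite sd_genM /=; have [<- <-] := angle_derE E x y.
have qgP : is_qg (@sd_map K g E).
  split=> [|x y|]; [exact: sd_map_hom | | exact: sd_map_gen].
  by rewrite sd_map_in angle_mapE.
have qg_uniq qg : is_qg qg -> @sd_map K g E = qg.
  move=> [[qgl _] qgE qggen]; apply/funext/sd_linear_eq => // [|x y|].
  - exact: sd_map_linear.
  - by rewrite sd_map_in angle_mapE qgE.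
  - by rewrite sd_map_gen qggen.
have surj (x : g) : exists p : semidirect D, x = sd_map p.
  have h2' : (2 : K) != 0 by rewrite -unitfE.
  have [|w [a ->]] := three_graded_sum h2' hE _ x; first by rewrite h0.
  by exists (w, a).
split=> [|_ /qg_uniq <-]; first by exists (@sd_map K g E).
split=> [|h F q _ qC qF].
  split; [by case: qgP | | ].
    by apply/seteqP; split=> // x _; have [p ->] := surj x; exists p.
  by move=> p /= p0 p'; rewrite sd_bracketE p0 angC linear0 oppr0.
have [alpha [alphaM qalpha alphagen]] := sd_central_extension_lift qC qF.
exists alpha; split=> // f [fM qf fgen].
have qaf : q \o alpha =1 q \o f by rewrite qalpha qf.
apply/funext/sd_linear_eq => [||x y|]; [by case: alphaM | by case: fM | | by rewrite fgen].
have [[p ->] [p' ->]] := (surj x, surj y); rewrite -sd_bracketE.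
exact: (hom_eq_on_brackets qC alphaM fM qaf p p').
Qed.
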